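(* Let $(\bar J_1,\bar J_2)$ be a pair of anti-commuting complex structures on a manifold $\bar M$ (i.e. integrable almost complex structures with $\bar J_1\bar J_2=-\bar J_2\bar J_1$), and let $\bar J_{a,b}:=a\bar J_1+b\bar J_2$, where $a,b$ are nonzero real numbers with $a^2+b^2=1$. Then $\bar J_{a,b}$ is integrable if and only if the Frölicher–Nijenhuis bracket $[\bar J_1,\bar J_2]$ of $\bar J_1$ and $\bar J_2$ vanishes.
   Context: An almost complex structure on $\bar M$ is an endomorphism $\bar J$ of $T\bar M$ with $\bar J^2=-I$. The Nijenhuis tensor field of a $(1,1)$-tensor field $\bar J$ is $$N_{\bar J}(X,Y):=[\bar JX,\bar JY]-\bar J[\bar JX,Y]-\bar J[X,\bar JY]+\bar J^2[X,Y]$$ for vector fields $X,Y$ on $\bar M$; $\bar J$ is integrable if $N_{\bar J}=0$, and an integrable almost complex structure is called a complex structure. The Frölicher–Nijenhuis bracket of $\bar J_1$ and $\bar J_2$ is $$[\bar J_1,\bar J_2](X,Y):=[\bar J_1X,\bar J_2Y]+[\bar J_2X,\bar J_1Y]+\bar J_1\bar J_2[X,Y]+\bar J_2\bar J_1[X,Y]-\bar J_1[\bar J_2X,Y]-\bar J_1[X,\bar J_2Y]-\bar J_2[\bar J_1X,Y]-\bar J_2[X,\bar J_1Y].$$ *)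

(* Defs.v *)
From HB Require Import structures.
From mathcomp Require Import all_boot all_order all_algebra.
From mathcomp Require Import all_classical all_reals topology normedtype derive.
From mathcomp Require Import ring.

Set Implicit Arguments.
Unset Strict Implicit.
Unset Printing Implicit Defensive.

Import Order.TTheory GRing.Theory Num.Theory.
Import numFieldNormedType.Exports.

Local Open Scope classical_set_scope.
Local Open Scope ring_scope.

Section Smooth.
Variables (R : realType) (V W : normedModType R).
Implicit Types (U : set V) (f : V -> W).

(* Meant for [U] open and [V] finite-dimensional: all iterated directional
   derivatives of order at most [k] exist and are continuous on [U]. Then
   the value of ['D_v f] on [U] only depends on the restriction of [f] to [U]. *)
Fixpoint Ck (k : nat) U f : Prop :=
  {in U, continuous f} /\
  if k is k'.+1 then
    forall v : V, {in U, forall x, derivable f x v} /\ Ck k' U ('D_v f)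
  else True.

Definition smooth_on U f := forall k, Ck k U f.

Lemma Ck_continuous k U f : Ck k U f -> {in U, continuous f}.
Proof. by case: k => [|k] []. Qed.

Lemma CkS k U f : Ck k.+1 U f -> Ck k U f.
Proof.
elim: k f => [|k IH] f; first by move=> [].
move=> [fc fd]; split => // v; have [dv Cv] := fd v.
by split => //; apply: IH.
Qed.

Lemma Ck_ext k U f g : open U -> {in U, f =1 g} -> Ck k U f -> Ck k U g.
Proof.
move=> oU; have ev (h1 h2 : V -> W) x : {in U, h1 =1 h2} -> x \in U ->
    \near x, h1 x = h2 x.
  move=> h12 /set_mem Ux; near=> y; apply: h12; apply: mem_set.
  near: y; exact: open_nbhs_nbhs.
elim: k f g => [|k IH] f g fg /=.
  move=> [fc _]; split => // x xU; rewrite /continuous_at -fg //.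
  apply: cvg_trans (fc x xU); apply: near_eq_cvg; exact: (ev f g).
move=> [fc fd]; split => [x xU|v].
  rewrite /continuous_at -fg //.
  apply: cvg_trans (fc x xU); apply: near_eq_cvg; exact: (ev f g).
have [dv Cv] := fd v; split => [x xU|].
  by apply: near_eq_derivable (dv x xU); apply: (ev f g).
apply: IH Cv => x xU; apply: near_eq_derive; exact: (ev f g).
Unshelve. all: by end_near. Qed.

Lemma Ck_cst k U (w : W) : Ck k U (cst w).
Proof.
elim: k w => [|k IH] w /=; split; try by move=> x _; exact: cvg_cst.
  by [].
move=> v; split; first by move=> x _; exact: derivable_cst.
have -> : 'D_v (cst w) = cst (0 : W) :> (V -> W).
  by apply/funext => x; rewrite derive_cst.
exact: IH.
Qed.

Lemma CkD k U f g : open U -> Ck k U f -> Ck k U g -> Ck k U (f + g).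
Proof.
move=> oU; elim: k f g => [|k IH] f g [fc fd] [gc gd] /=; split => //.
- by move=> x xU; apply: cvgD; [exact: fc|exact: gc].
- by move=> x xU; apply: cvgD; [exact: fc|exact: gc].
move=> v; have [dfv Cfv] := fd v; have [dgv Cgv] := gd v; split.
  by move=> x xU; apply: derivableD; [exact: dfv|exact: dgv].
apply: (@Ck_ext _ _ ('D_v f + 'D_v g)) => //; last exact: IH.
by move=> x xU /=; rewrite deriveD; [|exact: dfv|exact: dgv].
Qed.

Lemma CkZ k U (a : R) f : open U -> Ck k U f -> Ck k U (a *: f).
Proof.
move=> oU; elim: k f => [|k IH] f [fc fd] /=; split => //.
- by move=> x xU; apply: cvgZl_tmp; exact: fc.
- by move=> x xU; apply: cvgZl_tmp; exact: fc.
move=> v; have [dfv Cfv] := fd v; split.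
  by move=> x xU; apply: derivableZ; exact: dfv.
apply: (@Ck_ext _ _ (a *: 'D_v f)) => //; last exact: IH.
by move=> x xU /=; rewrite deriveZ; [|exact: dfv].
Qed.

End Smooth.

Lemma CkM (R : realType) (V : normedModType R) k (U : set V) (f g : V -> R^o) :
  open U -> Ck k U f -> Ck k U g -> Ck k U (f * g).
Proof.
move=> oU; elim: k f g => [|k IH] f g Cf Cg.
  split => // x xU; apply: cvgM.
    exact: (Ck_continuous Cf).
  exact: (Ck_continuous Cg).
have [fc fd] := Cf; have [gc gd] := Cg; split.
  by move=> x xU; apply: cvgM; [exact: fc|exact: gc].
move=> v; have [dfv Cfv] := fd v; have [dgv Cgv] := gd v; split.
  by move=> x xU; apply: derivableM; [exact: dfv|exact: dgv].
apply: (@Ck_ext _ _ _ _ _ (f * 'D_v g + g * 'D_v f)) => //.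
  by move=> x xU /=; rewrite deriveM; [|exact: dfv|exact: dgv].
by apply: CkD => //; apply: IH => //; exact: CkS.
Qed.

(* The values of [cmap] off [cdom] and of [cinv] off [cmap @` cdom] are junk. *)
Record chart (R : realType) (n : nat) (T : topologicalType) := Chart {
  cdom : set T;
  cmap : T -> 'rV[R]_n;
  cinv : 'rV[R]_n -> T;
  cdom_open : open cdom;
  cimg_open : open (cmap @` cdom);
  cmapK : {in cdom, cancel cmap cinv};
  cmap_continuous : {in cdom, continuous cmap};
  cinv_continuous : {in cmap @` cdom, continuous cinv}
}.

Definition smoothly_compatible (R : realType) n (T : topologicalType)
    (c d : chart R n T) : Prop :=
  smooth_on (cmap c @` (cdom c `&` cdom d)) (cmap d \o cinv c).

(* The atlas need not be maximal: smoothness of functions, hence everything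
   below, only depends on the maximal atlas it generates. *)
Record manifold (R : realType) (n : nat) := Manifold {
  mcarrier :> topologicalType;
  mhausdorff : hausdorff_space mcarrier;
  msecond_countable : @second_countable mcarrier;
  atlas : set (chart R n mcarrier);
  atlas_cover : \bigcup_(c in atlas) cdom c = [set: mcarrier];
  atlas_compatible :
    forall c d, atlas c -> atlas d -> smoothly_compatible c d
}.

Section Geometry.
Variables (R : realType) (n : nat) (M : manifold R n).

Definition smooth_fun : set (M -> R^o) := [set f : (M -> R^o) |
  forall c, atlas c -> smooth_on (cmap c @` cdom c) (f \o cinv c)].

Definition smooth_pred : {pred M -> R^o} := mem smooth_fun.

Lemma smooth_cst (a : R) : smooth_fun (cst a).
Proof. by move=> c _ k; exact: Ck_cst. Qed.

Lemma smooth_subring_closed : subring_closed smooth_pred.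
Proof.
split; first by apply/mem_set; exact: smooth_cst.
- move=> f g /set_mem sf /set_mem sg; apply/mem_set => c ac k.
  have -> : (f - g) \o cinv c = f \o cinv c + (-1 : R) *: (g \o cinv c).
    by rewrite scaleN1r.
  apply: CkD; [exact: cimg_open|exact: sf|].
  by apply: CkZ; [exact: cimg_open|exact: sg].
- move=> f g /set_mem sf /set_mem sg; apply/mem_set => c ac k.
  by apply: CkM; [exact: cimg_open|exact: sf|exact: sg].
Qed.

HB.instance Definition _ :=
  GRing.isSubringClosed.Build (M -> R^o) smooth_pred smooth_subring_closed.

Lemma smooth_scaler_closed : GRing.scaler_closed smooth_pred.
Proof.
move=> a f /set_mem sf; apply/mem_set => c ac k.
by apply: CkZ; [exact: cimg_open|exact: sf].
Qed.

HB.instance Definition _ :=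
  GRing.isScaleClosed.Build R (M -> R^o) smooth_pred smooth_scaler_closed.

Record Cinf : Type := MkCinf {
  cinf_fun :> M -> R^o;
  cinf_smooth : cinf_fun \in smooth_pred
}.

HB.instance Definition _ := [isSub for cinf_fun].
HB.instance Definition _ := [Choice of Cinf by <:].
HB.instance Definition _ := GRing.SubChoice_isSubComPzRing.Build
  (M -> R^o) smooth_pred Cinf smooth_subring_closed.
HB.instance Definition _ := [SubZmodule_isSubLmodule of Cinf by <:].

(* The tangent space at [p] is the space of derivations at [p] of Cinf. *)
Definition derivation_at (p : M) : set (Cinf -> R^o) := [set D : (Cinf -> R^o) |
  (forall (a : R) (f g : Cinf), D (a *: f + g) = a *: D f + D g) /\
  (forall f g : Cinf, D (f * g) = f p * D g + g p * D f)].

Definition derivation_pred (p : M) : {pred Cinf -> R^o} :=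
  mem (derivation_at p).

Lemma derivation_submod_closed (p : M) :
  GRing.submod_closed (derivation_pred p).
Proof.
split.
  apply/mem_set; split => [a f g|f g] /=; first by rewrite scaler0 addr0.
  by rewrite !mulr0 addr0.
move=> a D E /set_mem [lD dD] /set_mem [lE dE]; apply/mem_set.
split => [b f g|f g].
  change (a * D (b *: f + g) + E (b *: f + g) =
          b * (a * D f + E f) + (a * D g + E g)).
  rewrite lD lE !mulrDr !mulrA (mulrC b a) !addrA; congr (_ + _).
  by rewrite -!addrA; congr (_ + _); rewrite addrC.
change (a * D (f * g) + E (f * g) =
        f p * (a * D g + E g) + g p * (a * D f + E f)).
rewrite dD dE !mulrDr !mulrA (mulrC a (f p)) (mulrC a (g p)).
by rewrite addrACA.
Qed.

HB.instance Definition _ (p : M) := GRing.isSubmodClosed.Build R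
  (Cinf -> R^o) (derivation_pred p) (derivation_submod_closed p).

Record tangent (p : M) : Type := Tangent {
  tangent_fun :> Cinf -> R^o;
  tangent_derivation : tangent_fun \in derivation_pred p
}.

HB.instance Definition _ (p : M) := [isSub for @tangent_fun p].
HB.instance Definition _ (p : M) := [Choice of tangent p by <:].
HB.instance Definition _ (p : M) := [SubChoice_isSubLmodule of tangent p by <:].

(* By Hausdorffness and second countability (bump functions), this amounts to
   the components of [X] in every chart being smooth. *)
Definition smooth_section (X : forall p : M, tangent p) : Prop :=
  forall f : Cinf, smooth_fun (fun p => X p f).

Record vector_field : Type := VectorField {
  vf_at :> forall p : M, tangent p;
  vf_smooth : smooth_section vf_at
}.

Definition vf_apply (X : vector_field) (f : Cinf) : Cinf :=
  MkCinf (mem_set (vf_smooth X f)).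

Lemma lie_derivation (X Y : vector_field) (p : M) :
  (fun f => X p (vf_apply Y f) - Y p (vf_apply X f)) \in derivation_pred p.
Proof.
have vfZD (Z : vector_field) a f g :
    vf_apply Z (a *: f + g) = a *: vf_apply Z f + vf_apply Z g.
  apply/val_inj/funext => q.
  by have [lin _] := set_mem (tangent_derivation (Z q)); exact: lin.
have vfM (Z : vector_field) f g :
    vf_apply Z (f * g) = f * vf_apply Z g + g * vf_apply Z f.
  apply/val_inj/funext => q.
  by have [_ der] := set_mem (tangent_derivation (Z q)); exact: der.
have [lX dX] := set_mem (tangent_derivation (X p)).
have [lY dY] := set_mem (tangent_derivation (Y p)).
have aX (f g : Cinf) : X p (f + g) = X p f + X p g.
  by have := lX 1 f g; rewrite !scale1r.
have aY (f g : Cinf) : Y p (f + g) = Y p f + Y p g.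
  by have := lY 1 f g; rewrite !scale1r.
apply/mem_set; split => [a f g|f g] /=.
  rewrite !vfZD lX lY scalerBr opprD !addrA; congr (_ - _).
  by rewrite -!addrA; congr (_ + _); rewrite addrC.
rewrite !vfM aX aY !dX !dY.
change (f p * X p (vf_apply Y g) + Y p g * X p f +
    (g p * X p (vf_apply Y f) + Y p f * X p g) -
    (f p * Y p (vf_apply X g) + X p g * Y p f +
    (g p * Y p (vf_apply X f) + X p f * Y p g)) =
  f p * (X p (vf_apply Y g) - Y p (vf_apply X g)) +
  g p * (X p (vf_apply Y f) - Y p (vf_apply X f)) :> R).
ring.
Qed.

Definition lie_bracket_at (X Y : vector_field) (p : M) : tangent p :=
  Tangent (lie_derivation X Y p).

Lemma lie_smooth (X Y : vector_field) : smooth_section (lie_bracket_at X Y).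
Proof.
move=> f; apply/set_mem.
exact: (cinf_smooth (vf_apply X (vf_apply Y f) - vf_apply Y (vf_apply X f))).
Qed.

Definition lie_bracket (X Y : vector_field) : vector_field :=
  VectorField (lie_smooth X Y).

(* An endomorphism of the tangent bundle, i.e. a smooth (1,1)-tensor field.
   A fiberwise linear map is smooth iff it preserves smooth vector fields. *)
Record endomorphism : Type := Endomorphism {
  endo_at :> forall p : M, {linear tangent p -> tangent p};
  endo_smooth : forall X : vector_field,
    smooth_section (fun p => endo_at p (X p))
}.

Definition endo_apply (J : endomorphism) (X : vector_field) : vector_field :=
  VectorField (endo_smooth J X).

Lemma endo_lincomb_smooth (a : R) (J : endomorphism) (b : R) (K : endomorphism)
    (X : vector_field) :
  smooth_section (fun p => (a \*: J p \+ b \*: K p) (X p)).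
Proof.
move=> f; apply/set_mem.
exact: (cinf_smooth
  (a *: vf_apply (endo_apply J X) f + b *: vf_apply (endo_apply K X) f)).
Qed.

Definition endo_lincomb (a : R) (J : endomorphism) (b : R) (K : endomorphism) :
    endomorphism :=
  @Endomorphism (fun p => a \*: J p \+ b \*: K p)
    (endo_lincomb_smooth a J b K).

Definition almost_complex (J : endomorphism) : Prop :=
  forall (p : M) (v : tangent p), J p (J p v) = - v.

Definition anti_commuting (J1 J2 : endomorphism) : Prop :=
  forall (p : M) (v : tangent p), J1 p (J2 p v) = - J2 p (J1 p v).

Local Notation "[[ X , Y ]]" := (lie_bracket X Y) (at level 0).

Definition nijenhuis (J : endomorphism) (X Y : vector_field) (p : M) :
    tangent p :=
  [[endo_apply J X, endo_apply J Y]] p - J p ([[endo_apply J X, Y]] p)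
  - J p ([[X, endo_apply J Y]] p) + J p (J p ([[X, Y]] p)).

Definition integrable (J : endomorphism) : Prop :=
  forall X Y p, nijenhuis J X Y p = 0.

Definition complex_structure (J : endomorphism) : Prop :=
  almost_complex J /\ integrable J.

Definition fn_bracket (J1 J2 : endomorphism) (X Y : vector_field) (p : M) :
    tangent p :=
  [[endo_apply J1 X, endo_apply J2 Y]] p
  + [[endo_apply J2 X, endo_apply J1 Y]] p
  + J1 p (J2 p ([[X, Y]] p)) + J2 p (J1 p ([[X, Y]] p))
  - J1 p ([[endo_apply J2 X, Y]] p) - J1 p ([[X, endo_apply J2 Y]] p)
  - J2 p ([[endo_apply J1 X, Y]] p) - J2 p ([[X, endo_apply J1 Y]] p).

End Geometry.

(* Main.v *)
Require Import Defs.
From mathcomp Require Import all_boot all_order all_algebra.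
From mathcomp Require Import all_classical all_reals topology normedtype derive.
From mathcomp Require Import ring.

Import GRing.Theory Num.Theory.
Local Open Scope ring_scope.

(** The Nijenhuis tensor is a quadratic expression in the endomorphism, and
    the Froelicher-Nijenhuis bracket is its polarization:
      N_{a J1 + b J2} = a^2 N_{J1} + b^2 N_{J2} + a b [J1, J2]
    ([nijenhuis_lincomb]).  This follows by expanding with the bilinearity of
    the Lie bracket over the reals ([lie_bracketl], [lie_bracketr]) and the
    fiberwise linearity of J1 and J2.  When J1 and J2 are integrable the two
    square terms vanish, and since a b is invertible, the left-hand side
    vanishes exactly when [J1, J2] does. *)

Section Bracket.
Context {R : realType} {n : nat} {M : manifold R n}.

Lemma tangent_ext (p : M) (u v : tangent p) :
  (forall f : Cinf M, u f = v f :> R) -> u = v.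
Proof. by move=> uv; apply/val_inj/funext. Qed.

Lemma tangentDE (p : M) (u v : tangent p) (f : Cinf M) :
  (u + v) f = u f + v f :> R.
Proof. by []. Qed.

Lemma tangentNE (p : M) (u : tangent p) (f : Cinf M) : (- u) f = - u f :> R.
Proof. by []. Qed.

Lemma tangentZE (p : M) (a : R) (u : tangent p) (f : Cinf M) :
  (a *: u) f = a * u f :> R.
Proof. by []. Qed.

Definition tangentE := (tangentDE, tangentNE, tangentZE).

Lemma tangent_lincomb (p : M) (u : tangent p) (a b : R) (f g : Cinf M) :
  u (a *: f + b *: g) = a * u f + b * u g.
Proof.
have [lin _] := set_mem (tangent_derivation u).
have u0 : u 0 = 0.
  by have := lin (-1) 0 0; rewrite scaler0 addr0 scaleN1r addNr.
by rewrite lin -[b *: g]addr0 lin u0 addr0.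
Qed.

(** Vector fields carry no module structure here, so that a linear
    combination is given by its values at all points.  The hypothesis at the
    single point [p] would not suffice, as the bracket differentiates [X]. *)
Lemma lie_bracketl (a b : R) (X X1 X2 Y : vector_field M) (p : M) :
    (forall q, X q = a *: X1 q + b *: X2 q) ->
  lie_bracket X Y p = a *: lie_bracket X1 Y p + b *: lie_bracket X2 Y p.
Proof.
move=> XE; apply: tangent_ext => f; rewrite !tangentE /=.
have -> : vf_apply X f = a *: vf_apply X1 f + b *: vf_apply X2 f.
  by apply/val_inj/funext => q; rewrite /= XE.
rewrite XE !tangentE tangent_lincomb !mulrBr opprD.
exact: addrACA.
Qed.

Lemma lie_bracketC (X Y : vector_field M) (p : M) :
  lie_bracket X Y p = - lie_bracket Y X p.
Proof. by apply: tangent_ext => f; apply/esym/opprB. Qed.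

Lemma lie_bracketr (a b : R) (X Y Y1 Y2 : vector_field M) (p : M) :
    (forall q, Y q = a *: Y1 q + b *: Y2 q) ->
  lie_bracket X Y p = a *: lie_bracket X Y1 p + b *: lie_bracket X Y2 p.
Proof.
move=> YE; rewrite lie_bracketC (lie_bracketl a b _ Y1 Y2) // opprD -!scalerN.
by rewrite -!lie_bracketC.
Qed.

(** In the expansion each term of the Nijenhuis tensor is quadratic in the
    endomorphism: the diagonal parts reassemble into N_{J1} and N_{J2}, while
    its two cross parts are two of the eight terms of [J1, J2]. *)
Lemma nijenhuis_lincomb (J1 J2 : endomorphism M) (a b : R)
    (X Y : vector_field M) (p : M) :
  nijenhuis (endo_lincomb a J1 b J2) X Y p =
    a ^+ 2 *: nijenhuis J1 X Y p + b ^+ 2 *: nijenhuis J2 X Y p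
    + (a * b) *: fn_bracket J1 J2 X Y p.
Proof.
set J := endo_lincomb a J1 b J2.
have JE (q : M) (v : tangent q) : J q v = a *: J1 q v + b *: J2 q v by [].
have JV (Z : vector_field M) (q : M) :
    endo_apply J Z q = a *: endo_apply J1 Z q + b *: endo_apply J2 Z q.
  exact: JE.
rewrite /nijenhuis /fn_bracket.
rewrite (lie_bracketl a b _ _ _ (endo_apply J Y) _ (JV X)).
rewrite !(lie_bracketr a b _ _ _ _ _ (JV Y)) (lie_bracketl a b _ _ _ Y _ (JV X)).
rewrite !JE !linearD !linearZ /=.
(* Both sides are now combinations of the same vectors; on a test function
   the equality becomes a polynomial identity in the scalars. *)
by apply: tangent_ext => f; rewrite !tangentE; ring.
Qed.

End Bracket.

Theorem proposition2p4 (R : realType) (n : nat) (M : manifold R n)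
    (J1 J2 : endomorphism M) (a b : R) :
  complex_structure J1 -> complex_structure J2 -> anti_commuting J1 J2 ->
  a != 0 -> b != 0 -> a ^+ 2 + b ^+ 2 = 1 ->
  integrable (endo_lincomb a J1 b J2) <->
  (forall (X Y : vector_field M) (p : M), fn_bracket J1 J2 X Y p = 0).
Proof.
move=> [_ N1] [_ N2] _ a0 b0 _.
have NE X Y p : nijenhuis (endo_lincomb a J1 b J2) X Y p =
    (a * b) *: fn_bracket J1 J2 X Y p.
  by rewrite nijenhuis_lincomb N1 N2 !scaler0 !add0r.
split=> [N X Y p|F X Y p]; last by rewrite NE F scaler0.
apply/eqP; have /eqP := N X Y p.
by rewrite NE scaler_eq0 mulf_eq0 (negPf a0) (negPf b0).
Qed.
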